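(* For each integer $k\ge 1$ let $f(k)$ be the smallest number such that every digraph $D$ with $\delta^+(D)\ge f(k)$ contains $k$ vertex-disjoint directed cycles. Suppose that for every integer $a\ge 2$, every edge-colored graph $G$ with $\delta^c(G)\ge a+3$ has an $(a,2)$-feasible partition. Then $f(k)\le 3k-1$ for every $k\ge 1$.
   Context: All graphs and digraphs are finite and simple (digraphs have no loops and no parallel arcs; two arcs $uv$ and $vu$ in opposite directions are allowed), and have non-empty vertex set. $\delta^+(D)$ is the minimum out-degree of the digraph $D$. The number $f(k)$ exists by a theorem of Thomassen. An edge-colored graph is a graph together with an arbitrary (not necessarily proper) assignment of a color to each edge. For a vertex $v$ of an edge-colored graph $G$, the color degree $d^c_G(v)$ is the number of distinct colors appearing on the edges of $G$ incident with $v$, and $\delta^c(G)=\min\{d^c_G(v): v\in V(G)\}$. $G$ has an $(a,b)$-feasible partition if $V(G)$ can be partitioned into two non-empty sets $A,B$ with $\delta^c(G[A])\ge a$ and $\delta^c(G[B])\ge b$, where induced subgraphs inherit the edge-coloring. *)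

(* Defs.v *)
From mathcomp Require Import all_boot.

Set Implicit Arguments.
Unset Strict Implicit.
Unset Printing Implicit Defensive.

(* Non-emptiness of the vertex set is not part of the structures [digraph] and
   [ecgraph]; it is an explicit hypothesis [0 < #|D|] wherever a (di)graph is
   quantified over. *)

Record digraph := Digraph {
  dvertex :> finType;
  arc : rel dvertex;
  arc_irr : irreflexive arc
}.

Definition outdeg (D : digraph) (v : D) : nat := #|[set w | arc v w]|.

(* The default #|D| bounds every out-degree, so for non-empty D this is the
   minimum; see [leq_min_outdeg]. *)
Definition min_outdeg (D : digraph) : nat :=
  \big[minn/#|D|]_(v : D) outdeg v.

(* [ucycle] allows the empty sequence, hence the first conjunct.  There are no
   loops, so a directed cycle has length at least 2, and 2-cycles count. *)
Definition dicycle (D : digraph) (c : seq D) : Prop :=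
  c <> [::] /\ ucycle (@arc D) c.

Definition has_disjoint_dicycles (D : digraph) (k : nat) : Prop :=
  exists c : 'I_k -> seq D,
    (forall i, dicycle (c i)) /\
    (forall i j, i != j -> [disjoint c i & c j]).

Definition outdeg_forces_dicycles (k n : nat) : Prop :=
  forall D : digraph, 0 < #|D| -> n <= min_outdeg D ->
    has_disjoint_dicycles D k.

(* The relation "f(k) = n". *)
Definition is_f (k n : nat) : Prop :=
  outdeg_forces_dicycles k n /\
  (forall m, outdeg_forces_dicycles k m -> n <= m).

(* [ecol u v] is meaningful only when u and v are adjacent.  A finite type of
   colors loses nothing, the graphs being finite; not every color need occur. *)
Record ecgraph := ECGraph {
  vertex :> finType;
  color : finType;
  adj : rel vertex;
  ecol : vertex -> vertex -> color;
  adj_sym : symmetric adj;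
  adj_irr : irreflexive adj;
  ecol_sym : forall u v, adj u v -> ecol u v = ecol v u
}.

Definition color_degree (G : ecgraph) (v : G) : nat :=
  #|[set ecol v w | w in [set w | adj v w]]|.

(* As for [min_outdeg]: the default bounds every color degree. *)
Definition min_color_degree (G : ecgraph) : nat :=
  \big[minn/#|color G|]_(v : G) color_degree v.

Section Induced.
Variables (G : ecgraph) (A : {set G}).

Let iadj : rel {v : G | v \in A} := fun u v => adj (val u) (val v).
Let iecol (u v : {v : G | v \in A}) : color G := ecol (val u) (val v).

Fact iadj_sym : symmetric iadj.
Proof. by move=> u v; apply: adj_sym. Qed.

Fact iadj_irr : irreflexive iadj.
Proof. by move=> u; apply: adj_irr. Qed.

Fact iecol_sym u v : iadj u v -> iecol u v = iecol v u.
Proof. exact: ecol_sym. Qed.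

Definition induced : ecgraph := ECGraph iadj_sym iadj_irr iecol_sym.

End Induced.

Definition feasible_partition (G : ecgraph) (a b : nat) : Prop :=
  exists A B : {set G},
    [/\ A != set0, B != set0, A :|: B = [set: G] & [disjoint A & B]] /\
    a <= min_color_degree (induced A) /\ b <= min_color_degree (induced B).

Lemma leq_bigminn (T : finType) (F : T -> nat) (N n : nat) :
  0 < #|T| -> (forall v, F v <= N) ->
  (n <= \big[minn/N]_(v : T) F v) <-> (forall v, n <= F v).
Proof.
move=> /card_gt0P[x0 _] FN; split=> [le_n v | le_n].
  apply: leq_trans le_n _; have := mem_index_enum v.
  elim: (index_enum T) => // x r IHr; rewrite inE big_cons geq_min.
  by case/predU1P=> [-> | /IHr ->]; rewrite ?leqnn ?orbT.
apply: (big_ind (fun m => n <= m)) => // [|m1 m2 h1 h2].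
  exact: leq_trans (le_n x0) (FN x0).
by rewrite leq_min h1 h2.
Qed.

Lemma leq_min_outdeg (D : digraph) (n : nat) : 0 < #|D| ->
  n <= min_outdeg D <-> (forall v : D, n <= outdeg v).
Proof. by move=> D0; apply: leq_bigminn => // v; apply: max_card. Qed.

Lemma leq_min_color_degree (G : ecgraph) (n : nat) : 0 < #|G| ->
  n <= min_color_degree G <-> (forall v : G, n <= color_degree v).
Proof. by move=> G0; apply: leq_bigminn => // v; apply: max_card. Qed.

Lemma is_f_unique (k m n : nat) : is_f k m -> is_f k n -> m = n.
Proof.
by move=> [Pm lem] [Pn len]; apply/eqP; rewrite eqn_leq lem // len.
Qed.

(* Main.v *)
From mathcomp Require Import all_boot.
From mathcomp Require Import zify.
From Stdlib Require Import Classical.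
Require Import Defs.

(** The bound holds because, by induction on the order of the digraph D,
    minimum out-degree at least 3k - 1 forces k disjoint dicycles
    ([outdeg_forces_dicycles_3k]).  For k = 1 it is enough that all out-degrees
    are positive ([has_dicycle]).

    Take k >= 2.  If u and v form a 2-cycle, that cycle is one of the k, and
    deleting u and v lowers out-degrees by at most 2, which is within the budget
    of 3 that one cycle less gives.  If v has no in-neighbour, deleting it
    changes no other out-degree.  Otherwise D has no 2-cycle, so it is an
    orientation of a simple graph; colour each edge by the head of its arc
    ([head_colored]).  The edges at v then show the out-neighbours of v as
    pairwise distinct colours, and the edges of arcs into v all show v itself.
    Hence the color degree of v is its out-degree plus 1 ([color_degree_ge]),
    so at least 3k = (3k - 3) + 3, and the assumption yields a (3k - 3, 2)-feasible
    partition into A and B.  In an induced part, color degree exceeds out-degree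
    by at most 1 ([outdeg_ge_color_degree]): out-degrees inside A are at least
    3(k - 1) - 1, which by induction gives k - 1 cycles in A, and out-degrees
    inside B are at least 1, which gives one more cycle in B.  Finally, some
    number forces k disjoint dicycles, so a least one does ([least_nat]). *)

Set Implicit Arguments.
Unset Strict Implicit.
Unset Printing Implicit Defensive.

(** * Induced subdigraphs and disjoint cycles *)

Section Subdigraph.
Variables (D : digraph) (S : {set D}).

Let sub_arc : rel {v : D | v \in S} := fun u v => arc (val u) (val v).

Fact sub_arc_irr : irreflexive sub_arc.
Proof. by move=> u; apply: arc_irr. Qed.

Definition subdigraph : digraph := Digraph sub_arc_irr.

Lemma outdeg_subdigraph (v : subdigraph) :
  outdeg v = #|[set w | arc (val v) w] :&: S|.
Proof.
rewrite /outdeg -(card_imset _ val_inj); apply: eq_card => w.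
rewrite !inE; apply/imsetP/andP => [[x] | [vw Sw]].
  by rewrite inE => vx ->; split=> //; apply: (valP x).
by exists (Sub w Sw) => //; rewrite inE.
Qed.

Lemma dicycle_subdigraph (c : seq subdigraph) :
  dicycle c -> dicycle (map val c : seq D).
Proof.
case=> c0 /andP[cyc Uc]; split; first by case: c c0 {cyc Uc}.
rewrite /ucycle (map_inj_uniq val_inj) Uc andbT.
by rewrite cycle_map.
Qed.

End Subdigraph.

Lemma card_subdigraph (D : digraph) (S : {set D}) : #|subdigraph S| = #|S|.
Proof. by rewrite card_sig. Qed.

Lemma has_disjoint_dicycles0 (D : digraph) : has_disjoint_dicycles D 0.
Proof. by exists (fun=> [::]); split; case. Qed.

Lemma has_disjoint_dicyclesD (D : digraph) (A B : {set D}) (m n : nat) :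
  [disjoint A & B] ->
  has_disjoint_dicycles (subdigraph A) m ->
  has_disjoint_dicycles (subdigraph B) n ->
  has_disjoint_dicycles D (m + n).
Proof.
move=> dAB [c [cP cD]] [d [dP dD]].
pose e (i : 'I_(m + n)) : seq D :=
  match split i with inl j => map val (c j) | inr j => map val (d j) end.
have inside (S : {set D}) (s : seq (subdigraph S)) : {subset map val s <= S}.
  by move=> x /mapP[y _ ->]; apply: (valP y).
have disj_map (S : {set D}) (s t : seq (subdigraph S)) :
    [disjoint s & t] -> [disjoint map val s & (map val t : seq D)].
  move=> dst; rewrite disjoint_has; apply/hasPn => x /mapP[y sy ->] /=.
  by rewrite mem_map ?(disjointFr dst sy) //; apply: val_inj.
have disj_across i j : [disjoint map val (c i) & (map val (d j) : seq D)].
  apply/pred0P => x /=; apply/andP => -[/inside xA /inside xB].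
  by rewrite (disjointFr dAB xA) in xB.
exists e; split=> [i | i j].
  by rewrite /e; case: (split i) => j; apply: dicycle_subdigraph.
rewrite -(inj_eq (can_inj (@splitK m n))) /e.
case: (split i) (split j) => [i'|i'] [j'|j'] ne_ij //.
- by apply/disj_map/cD; apply: contraNneq ne_ij => ->.
- by rewrite disjoint_sym; apply: disj_across.
- by apply/disj_map/dD; apply: contraNneq ne_ij => ->.
Qed.

Lemma has_disjoint_dicycles_sub (D : digraph) (A : {set D}) (m : nat) :
  has_disjoint_dicycles (subdigraph A) m -> has_disjoint_dicycles D m.
Proof.
move=> hA; rewrite -[m]addn0.
apply: has_disjoint_dicyclesD hA (has_disjoint_dicycles0 (subdigraph set0)).
by rewrite disjoint_sym; apply/pred0P => x /=; rewrite inE.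
Qed.

(** Following a fixed choice of out-neighbours from any vertex must eventually
    revisit a vertex, which then lies on a cycle of the choice function. *)
Lemma has_dicycle (D : digraph) :
  0 < #|D| -> (forall v : D, 0 < outdeg v) -> has_disjoint_dicycles D 1.
Proof.
move=> /card_gt0P[x _] out.
pose f (v : D) := odflt v [pick w | arc v w].
have fP v : arc v (f v).
  rewrite /f; case: pickP => //= no; have := out v.
  by case/card_gt0P=> w; rewrite inE no.
have /trajectP[i lt_i loop] := looping_order f x.
set y := iter i f x in loop.
have y_back : iter (order f x - i) f y = y.
  by rewrite /y -iterD subnK // ltnW.
have cyc : fcycle f (orbit f y).
  apply/(orbitPcycle 0 3); exists (order f x - i).-1.
  by rewrite prednK ?subn_gt0.
exists (fun=> orbit f y); split=> [_ | i1 j1]; last by rewrite !ord1.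
split; first by move: (in_orbit f y); case: (orbit f y).
rewrite /ucycle orbit_uniq andbT.
by apply: sub_cycle cyc => a b /eqP <-.
Qed.

(** * Colouring each edge by the head of its arc *)

Section HeadColoring.
Variable D : digraph.
Hypothesis no_digon : forall u v : D, arc u v -> ~~ arc v u.

Let head_adj : rel D := fun u v => arc u v || arc v u.
Let head (u v : D) : D := if arc u v then v else u.

Fact head_adj_sym : symmetric head_adj.
Proof. by move=> u v; rewrite /head_adj orbC. Qed.

Fact head_adj_irr : irreflexive head_adj.
Proof. by move=> u; rewrite /head_adj arc_irr. Qed.

Fact head_sym (u v : D) : head_adj u v -> head u v = head v u.
Proof.
rewrite /head_adj /head => /orP[] uv; rewrite uv (negbTE (no_digon uv)) //.
Qed.

Definition head_colored : ecgraph :=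
  ECGraph head_adj_sym head_adj_irr head_sym.

(** The in-arc uv is what adds the colour v to those of the out-neighbours. *)
Lemma color_degree_ge (u v : D) :
  arc u v -> (outdeg v).+1 <= color_degree (v : head_colored).
Proof.
move=> uv; have -> : (outdeg v).+1 = #|v |: [set w | arc v w]|.
  by rewrite cardsU1 inE arc_irr.
apply: subset_leq_card; apply/subsetP => w; rewrite !inE.
case/predU1P => [-> | vw]; apply/imsetP.
  exists u; first by rewrite inE /= /head_adj uv orbT.
  by rewrite /= /head (negbTE (no_digon uv)).
by exists w; rewrite ?inE /= /head_adj /head vw.
Qed.

(** Every edge at v inside A has as colour v itself or an out-neighbour of v,
    and in the second case that out-neighbour lies in A. *)
Lemma outdeg_ge_color_degree (A : {set D}) (v : subdigraph A) :
  color_degree (v : @induced head_colored A) <= (outdeg v).+1.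
Proof.
rewrite outdeg_subdigraph.
have: #|val v |: ([set w | arc (val v) w] :&: A)|
        <= (#|[set w | arc (val v) w] :&: A|).+1.
  by rewrite cardsU1; case: (_ \notin _).
apply: leq_trans; apply: subset_leq_card.
apply/subsetP => _ /imsetP[w _ ->]; rewrite !inE /= /head.
by case: ifP => vw; rewrite ?eqxx // vw (valP w) orbT.
Qed.

End HeadColoring.

(** * Forcing disjoint cycles *)

(** The colour that a vertex gains from its in-arcs in D, one more than its
    out-degree, makes up for the one that its in-arcs may account for inside its
    part.  So the bound on out-degrees falls by 3 in A, just as the one on
    color degrees does, and the bound 2 on color degrees in B leaves an out-arc. *)
Lemma dicycle_partition (D : digraph) (a : nat) :
  (forall G : ecgraph, 0 < #|G| -> a + 3 <= min_color_degree G ->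
     feasible_partition G a 2) ->
  0 < #|D| -> (forall u v : D, arc u v -> ~~ arc v u) ->
  (forall v : D, exists u : D, arc u v) ->
  (forall v : D, a + 2 <= outdeg v) ->
  exists A B : {set D},
    [/\ A != set0, B != set0 & [disjoint A & B]] /\
    (forall v : subdigraph A, a <= (outdeg v).+1) /\
    (forall v : subdigraph B, 0 < outdeg v).
Proof.
move=> part D0 nd src out; pose G := head_colored nd.
have degG : a + 3 <= min_color_degree G.
  apply/leq_min_color_degree => // v; have [u uv] := src v.
  by apply: leq_trans (color_degree_ge nd uv); rewrite addnS ltnS.
have [A [B [[A0 B0 _ dAB] [dA dB]]]] := part G D0 degG.
have nonempty (S : {set D}) : S != set0 -> 0 < #|@induced G S|.
  by rewrite -card_gt0 -card_subdigraph.
exists A, B; split=> //; split=> v.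
  apply: leq_trans (outdeg_ge_color_degree nd v).
  by move/leq_min_color_degree: dA; apply; apply: nonempty.
rewrite -ltnS; apply: leq_trans (outdeg_ge_color_degree nd v).
by move/leq_min_color_degree: dB; apply; apply: nonempty.
Qed.

Lemma outdeg_forces_dicycles_3k (k : nat) :
  (forall a : nat, 2 <= a ->
    forall G : ecgraph, 0 < #|G| -> a + 3 <= min_color_degree G ->
      feasible_partition G a 2) ->
  outdeg_forces_dicycles k (3 * k - 1).
Proof.
move=> part D D0 /leq_min_outdeg-/(_ D0).
have [n] := ubnP #|D|; elim: n => // n IHn in D k D0 * => /ltnSE-leDn out.
case: k out => [_ | [|k] out]; first exact: has_disjoint_dicycles0.
  by apply: has_dicycle => // v; apply: leq_trans (out v).
have bigD : 5 <= #|D|.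
  case/card_gt0P: D0 => v _; apply: leq_trans (max_card [set w | arc v w]).
  by apply: leq_trans (out v); lia.
have step (A : {set D}) m : A != set0 -> #|A| < #|D| ->
    (forall v : subdigraph A, 3 * m - 1 <= outdeg v) ->
    has_disjoint_dicycles (subdigraph A) m.
  rewrite -card_gt0 -card_subdigraph => A0 ltAD; apply: IHn => //.
  exact: leq_trans leDn.
have card_compl (S : {set D}) : #|~: S| = #|D| - #|S|.
  by rewrite cardsCs setCK.
have split_off (A B : {set D}) :
    A != set0 -> B != set0 -> [disjoint A & B] ->
    (forall v : subdigraph A, 3 * k.+1 - 1 <= outdeg v) ->
    (forall v : subdigraph B, 0 < outdeg v) ->
    has_disjoint_dicycles D k.+2.
  move=> A0 B0 dAB outA outB; rewrite -[k.+2]addn1.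
  apply: has_disjoint_dicyclesD (dAB) _ _.
    apply: step => //; apply: leq_trans (max_card (A :|: B)).
    have /eqP -> : #|A :|: B| == #|A| + #|B| by rewrite (leq_card_setU A B).
    by rewrite -addn1 leq_add2l card_gt0.
  by apply: has_dicycle outB; rewrite card_subdigraph card_gt0.
have [/existsP[u /existsP[v /andP[uv vu]]] | no_digon] :=
    boolP [exists u : D, exists v : D, arc u v && arc v u].
  have card_uv : #|[set u; v]| <= 2 by rewrite cards2; case: (_ != _).
  apply: (split_off (~: [set u; v]) [set u; v]).
  - by rewrite -card_gt0 card_compl; lia.
  - by apply/set0Pn; exists u; rewrite set21.
  - by rewrite -setI_eq0 setIC setICr.
  - move=> w; rewrite outdeg_subdigraph -setDE cardsD.
    have := subset_leq_card (subsetIr [set x | arc (val w) x] [set u; v]).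
    by have := out (val w); rewrite /outdeg; lia.
  - move=> w; rewrite outdeg_subdigraph; apply/card_gt0P.
    have := valP w; rewrite !inE => /orP[] /eqP ->.
      by exists v; rewrite !inE uv eqxx orbT.
    by exists u; rewrite !inE vu eqxx.
have [/existsP[v /forallP src] | no_source] :=
    boolP [exists v : D, forall u : D, ~~ arc u v].
  apply: (@has_disjoint_dicycles_sub _ (~: [set v])).
  apply: step; rewrite -?card_gt0 ?card_compl ?cards1; try lia.
  move=> w; rewrite outdeg_subdigraph (setIidPl _); first exact: out.
  apply/subsetP => x; rewrite !inE => wx.
  by apply: contraTneq wx => ->; apply: src.
(* With k.+2 cycles wanted, 3 * k.+1 is 3 less than three times their number. *)
have [] := @dicycle_partition D (3 * k.+1) (part _ _).
- lia.
- by [].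
- move=> u v uv; apply: contra no_digon => vu.
  by apply/existsP; exists u; apply/existsP; exists v; rewrite uv.
- move=> v; apply/existsP; apply: contraR no_source => no_in.
  by apply/existsP; exists v; rewrite -negb_exists.
- by move=> v; apply: leq_trans (out v); lia.
move=> A [B [[A0 B0 dAB] [outA outB]]].
by apply: (split_off A B) => // v; have := outA v; lia.
Qed.

(** P need not be decidable, whence the appeal to excluded middle. *)
Lemma least_nat (P : nat -> Prop) (n : nat) :
  P n -> exists m, (P m /\ forall i, P i -> m <= i) /\ m <= n.
Proof.
elim/ltn_ind: n => n IHn Pn.
have [[i [Pi lt_in]] | no] := classic (exists i, P i /\ i < n).
  have [m [mP le_mi]] := IHn i lt_in Pi.
  by exists m; split=> //; apply: leq_trans le_mi (ltnW lt_in).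
exists n; split=> //; split=> // i Pi; rewrite leqNgt.
by apply/negP => lt_in; apply: no; exists i.
Qed.

Theorem theorem1p8 :
  (forall a : nat, 2 <= a ->
    forall G : ecgraph, 0 < #|G| -> a + 3 <= min_color_degree G ->
      feasible_partition G a 2) ->
  forall k : nat, 1 <= k ->
    exists fk : nat, is_f k fk /\ fk <= 3 * k - 1.
Proof.
by move=> part k _; apply: least_nat; apply: outdeg_forces_dicycles_3k.
Qed.
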